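(* Let $G$ be a graph of density $p$ with $\mathrm{disc}^+(G) = \alpha > 0$. Then \[ f(G) \geq (1-p)^{-1/2} (2\alpha)^{1/2}. \]
   Context: Graphs are finite and simple. The density of a graph $G$ on $n \geq 2$ vertices is $p = |E(G)|/\binom{n}{2}$. A full subgraph of a graph $G$ of density $p$ is an $m$-vertex subgraph $H$ of $G$ of minimum degree at least $p(m-1)$; $f(G)$ denotes the largest number of vertices in a full subgraph of $G$. For $X \subseteq V(G)$, $e(X)$ is the number of edges of $G$ lying in $X$, and $\delta(X) = e(X) - p\binom{|X|}{2}$, where $p$ is the density of $G$. The positive discrepancy of $G$ is $\mathrm{disc}^+(G) = \max_{X \subseteq V(G)} \delta(X)$. *)

(* Defs.v *)
From HB Require Import structures.
From mathcomp Require Import all_boot all_order all_algebra.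

Set Implicit Arguments.
Unset Strict Implicit.
Unset Printing Implicit Defensive.

Import Order.TTheory GRing.Theory Num.Theory.
Local Open Scope ring_scope.

(* Edges are the two-element subsets {x, y} of the vertex set. *)
Record sgraph := SGraph {
  vertex :> finType;
  edges : {set {set vertex}};
  card_edge : forall e, e \in edges -> #|e| = 2%N
}.

Section FullSubgraphs.
Variables (R : rcfType) (G : sgraph).

(* Meaningful only for #|G| >= 2; equal to 0 otherwise since 0^-1 = 0. *)
Definition density : R := #|edges G|%:R / 'C(#|G|, 2)%:R.

(* A pair (S, F) of vertices and edges; S need not induce F. *)
Definition is_subgraph (H : {set G} * {set {set G}}) : bool :=
  (H.2 \subset edges G) && [forall e in H.2, e \subset H.1].

Definition degree (H : {set G} * {set {set G}}) (v : G) : nat :=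
  #|[set e in H.2 | v \in e]|.

(* The minimum degree condition is required at every vertex. The minimum
   degree of the graph without vertices being undefined, that graph is
   excluded. *)
Definition is_full (H : {set G} * {set {set G}}) : bool :=
  [&& is_subgraph H, H.1 != set0 &
    [forall v in H.1, density * (#|H.1|%:R - 1) <= (degree H v)%:R]].

(* One-vertex subgraphs are full, so the maximum is over a nonempty family. *)
Definition max_full : nat :=
  \max_(H : {set G} * {set {set G}} | is_full H) #|H.1|.

Definition edges_in (X : {set G}) : nat :=
  #|[set e in edges G | e \subset X]|.

Definition discrepancy (X : {set G}) : R :=
  (edges_in X)%:R - density * 'C(#|X|, 2)%:R.

(* The default value is itself one of the values being maximized. *)
Definition disc_plus : R :=
  \big[Num.max/discrepancy set0]_(X : {set G}) discrepancy X.

End FullSubgraphs.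

(* Main.v *)
(* A set X maximizing the discrepancy induces a full subgraph: deleting a vertex
   v of X changes the discrepancy by p(|X| - 1) - deg v, which is not positive.
   Since X spans at most 'C(|X|, 2) edges, alpha <= (1 - p) |X|^2 / 2. *)
Require Import Defs.
From HB Require Import structures.
From mathcomp Require Import all_boot all_order all_algebra.
From mathcomp Require Import ring lra.
Import Order.TTheory GRing.Theory Num.Theory.
Local Open Scope ring_scope.

Definition induced (G : sgraph) (X : {set G}) : {set G} * {set {set G}} :=
  (X, [set e in edges G | e \subset X]).

Lemma induced_is_subgraph (G : sgraph) (X : {set G}) :
  is_subgraph (induced G X).
Proof.
apply/andP; split; first by apply/subsetP=> e; rewrite inE => /andP[].
by apply/forall_inP=> e; rewrite inE => /andP[].
Qed.

Lemma edges_in_le_bin (G : sgraph) (X : {set G}) :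
  (edges_in X <= 'C(#|X|, 2))%N.
Proof.
rewrite -cards_draws; apply: subset_leq_card; apply/subsetP=> e.
by rewrite !inE => /andP[/card_edge -> ->].
Qed.

(** The edges inside [X] are sorted by whether they contain [v]; those avoiding [v] are exactly the
    edges inside [X :\ v]. *)
Lemma edges_in_setD1 (G : sgraph) (X : {set G}) (v : G) :
  edges_in X = (degree (induced G X) v + edges_in (X :\ v))%N.
Proof.
rewrite /edges_in /degree /= -(cardsID [set e : {set G} | v \in e]).
congr (_ + _)%N; apply: eq_card => e; rewrite !inE //.
by rewrite subsetD1 andbC -andbA.
Qed.

(** Turns binomials into polynomials over the field, as [field] and [nra] require. *)
Lemma natr_bin2 (R : numFieldType) (n : nat) :
  'C(n, 2)%:R = n%:R * (n%:R - 1) / 2 :> R.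
Proof.
suff <- : 'C(n, 2)%:R * 2 = n%:R * (n%:R - 1) :> R by rewrite mulfK ?pnatr_eq0.
(* At 0 the factor [n%:R - 1] is -1, not the truncated predecessor, so this case is separate. *)
case: n => [|n]; first by rewrite bin0n !mul0r.
by rewrite -natrM mulnC -mul_bin_diag bin1 natrM -natr1 addrK.
Qed.

(** The edges at [v] are lost, while the number of pairs drops by [#|X| - 1]. *)
Lemma discrepancy_setD1 (R : rcfType) (G : sgraph) (X : {set G}) (v : G) :
  v \in X ->
  discrepancy R (X :\ v) = discrepancy R X
    + density R G * (#|X|%:R - 1) - (degree (induced G X) v)%:R.
Proof.
move=> vX; rewrite /discrepancy (edges_in_setD1 G X v) natrD !natr_bin2.
by rewrite (cardsD1 v X) vX natrD /=; field.
Qed.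

Lemma discrepancy_le (R : rcfType) (G : sgraph) (X : {set G}) :
  discrepancy R X <= (1 - density R G) * 'C(#|X|, 2)%:R.
Proof. by rewrite mulrBl mul1r lerD2r ler_nat edges_in_le_bin. Qed.

Lemma max_discrepancy_full (R : rcfType) (G : sgraph) (X : {set G}) :
  X != set0 -> (forall Y : {set G}, discrepancy R Y <= discrepancy R X) ->
  is_full R (induced G X).
Proof.
move=> X0 maxX; apply/and3P; split; rewrite ?induced_is_subgraph //.
apply/forall_inP=> v vX; have := maxX (X :\ v).
by rewrite discrepancy_setD1 //= -addrA gerDl subr_le0.
Qed.

Lemma disc_plus_attained (R : rcfType) (G : sgraph) :
  exists X : {set G}, disc_plus R G = discrepancy R X /\
    forall Y : {set G}, discrepancy R Y <= discrepancy R X.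
Proof.
case: (@arg_maxP _ _ _ (set0 : {set G}) xpredT
        (@discrepancy R G)) => // X _ maxX.
have maxX' (Y : {set G}) : discrepancy R Y <= discrepancy R X by exact: maxX.
exists X; split=> //; apply/le_anti/andP; split.
  exact: bigmax_le.
exact: le_bigmax.
Qed.

Theorem theorem2 (R : rcfType) (G : sgraph) (p alpha : R)
    (hn : (2 <= #|G|)%N)
    (hp : density R G = p)
    (hdisc : disc_plus R G = alpha)
    (halpha : 0 < alpha) :
  (Num.sqrt (1 - p))^-1 * Num.sqrt (2 * alpha) <= (max_full R G)%:R.
Proof.
have [X [dX maxX]] := disc_plus_attained R G.
have alphaX : alpha = discrepancy R X by rewrite -hdisc.
have X0 : X != set0.
  (* The empty set has discrepancy at most 0, against [0 < alpha]. *)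
  apply: contraTneq halpha => X0; rewrite alphaX -leNgt.
  by apply: le_trans (discrepancy_le R G X) _; rewrite X0 cards0 mulr0.
have fullX := max_discrepancy_full R G X X0 maxX.
apply: (@le_trans _ _ (#|X|%:R)); last first.
  by rewrite ler_nat; exact: (leq_bigmax_cond (induced G X)).
(* If p >= 1 the square root, hence its inverse, is the junk value 0. *)
have [p1|p1] := lerP (1 - p) 0; first by rewrite ler0_sqrtr // invr0 mul0r.
rewrite mulrC ler_pdivrMr ?sqrtr_gt0 //.
(* With both sides written as square roots, it remains to compare radicands:
   [2 * alpha <= #|X| ^ 2 * (1 - p)]. *)
have <- : Num.sqrt (#|X|%:R ^+ 2) = #|X|%:R :> R by rewrite sqrtr_sqr ger0_norm.
rewrite -sqrtrM ?sqr_ge0 //; apply: ler_wsqrtr.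
have := discrepancy_le R G X; rewrite -alphaX hp natr_bin2.
have : 0 <= #|X|%:R :> R by exact: ler0n.
(* The slack between [#|X| * (#|X| - 1)] and [#|X| ^ 2] contributes [(1 - p) * #|X|], a product of
   nonnegative factors. *)
nra.
Qed.
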